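(* Let $\mathcal{P}$ be a finite polysquare translation surface, and let $\mathcal{M}=\mathcal{P}\times[0,1)$ be the associated polycube translation $3$-manifold, the cartesian product of $\mathcal{P}$ and the unit torus $[0,1)$. Let $\mathbf{v}=(v_1,v_2)\in\mathbb{R}^2$ be a Kronecker vector, i.e. $v_1,v_2,1$ are linearly independent over $\mathbb{Q}$, so that $\mathbf{v}^*=(v_1,v_2,1)\in\mathbb{R}^3$ is a Kronecker direction. Then the following two statements are equivalent: (i) Every half-infinite Kronecker sequence $\mathbf{v}_0+j\mathbf{v}$, $j=0,1,2,3,\ldots,$ with step vector $\mathbf{v}$ on $\mathcal{P}$ is uniformly distributed on $\mathcal{P}$. (ii) Every half-infinite geodesic $\mathcal{L}(t)$, $t\ge0$, with direction $\mathbf{v}^*$ in $\mathcal{M}$ is uniformly distributed in $\mathcal{M}$.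
   Context: A finite polysquare translation surface $\mathcal{P}$ is a connected surface obtained from finitely many, say $s$, unit squares with sides parallel to the axes (the atomic squares) by identifying their edges in pairs by translations (right edges with left edges, top edges with bottom edges). Its singularities are the vertices with total cone angle different from $2\pi$. The manifold $\mathcal{M}=\mathcal{P}\times[0,1)$, where $[0,1)=\mathbb{R}/\mathbb{Z}$ is the unit torus, consists of $s$ atomic cubes (atomic square times $[0,1)$); its singularities are the points $(p,z)$ with $p$ a singularity of $\mathcal{P}$. $\lambda_k$ denotes $k$-dimensional Lebesgue measure, so $\lambda_2(\mathcal{P})=\lambda_3(\mathcal{M})=s$. Geodesics: a geodesic $\mathcal{L}(t)$ with a given direction is the unit speed straight line motion in that direction, continued through the identifications; it is half-infinite if it is defined for all $t\ge0$, i.e. it does not hit a singularity. Kronecker sequences: given a starting point $\mathbf{v}_0\in\mathcal{P}$, let $\mathcal{L}(t)$ be the geodesic on $\mathcal{P}$ with $\mathcal{L}(0)=\mathbf{v}_0$ and direction $\mathbf{v}$. The sequence $\mathbf{v}_0+j\mathbf{v}$ is defined by $\mathbf{v}_0+j\mathbf{v}=\mathcal{L}(jg)$ with time step $g=|\mathbf{v}|$. The Kronecker sequence is half-infinite if and only if the supporting geodesic from $\mathbf{v}_0$ is half-infinite (does not hit a singularity). Uniform distribution: a sequence $\mathbf{x}_0,\mathbf{x}_1,\ldots$ on $\mathcal{P}$ is uniformly distributed if for every convex set $S$ contained in an atomic square, $\frac1J|\{0\le j\le J-1:\mathbf{x}_j\in S\}|\to\lambda_2(S)/s$ as $J\to\infty$.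 A half-infinite geodesic in $\mathcal{M}$ is uniformly distributed if for every convex set $S$ contained in an atomic cube, $\frac1T\lambda_1(\{0\le t\le T:\mathcal{L}(t)\in S\})\to\lambda_3(S)/s$ as $T\to\infty$. *)

(* Defs.v *)
From mathcomp Require Import all_boot all_order all_algebra all_fingroup.
From mathcomp Require Import all_classical all_reals all_analysis.
From Stdlib Require Import Relation_Operators.

Set Implicit Arguments.
Unset Strict Implicit.
Unset Printing Implicit Defensive.

Import Order.TTheory GRing.Theory Num.Theory.
Import numFieldNormedType.Exports.

Local Open Scope classical_set_scope.
Local Open Scope quotient_scope.
Local Open Scope ring_scope.

(* The right edge of the square [c] is identified with the left edge of
   [right_of c], and its top edge with the bottom edge of [top_of c].  Each
   left (bottom) edge is used exactly once, so both maps are permutations.  The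
   surface is connected iff the graph of edge-adjacent squares is. *)
Record polysquare := Polysquare {
  squares : finType;
  squares_gt0 : (0 < #|squares|)%N;
  right_of : {perm squares};
  top_of : {perm squares};
  squares_connected : forall a b : squares,
    connect (fun c d => [|| d == right_of c, c == right_of d,
                            d == top_of c | c == top_of d]) a b }.

(* [R^o] rather than [R], so that these are left modules over [R]. *)
Definition plane (R : realType) := (R^o * R^o)%type.
Definition space3 (R : realType) := (R^o * R^o * R^o)%type.

Definition unit_square (R : realType) : pred (plane R) :=
  fun p => (0 <= p.1 <= 1) && (0 <= p.2 <= 1).

Definition square_pt (R : realType) := {p : plane R | unit_square p}.

Section surface.
Variables (R : realType) (P : polysquare).

Definition raw_pt := (squares P * square_pt R)%type.

Definition edge_glue (a b : raw_pt) : Prop :=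
  [/\ b.1 = right_of P a.1, (val a.2).1 = 1, (val b.2).1 = 0
    & (val b.2).2 = (val a.2).2]
  \/
  [/\ b.1 = top_of P a.1, (val a.2).2 = 1, (val b.2).2 = 0
    & (val b.2).1 = (val a.2).1].

Definition glued (a b : raw_pt) : bool :=
  `[< clos_refl_sym_trans _ edge_glue a b >].

Lemma glued_refl : reflexive glued.
Proof. by move=> a; apply/asboolP; exact: rst_refl. Qed.

Lemma glued_sym : symmetric glued.
Proof. by move=> a b; apply/asboolP/asboolP => h; exact: rst_sym. Qed.

Lemma glued_trans : transitive glued.
Proof. by move=> b a c /asboolP ab /asboolP bc; apply/asboolP/(rst_trans _ _ a b c). Qed.

Canonical glued_equiv := EquivRel glued glued_refl glued_sym glued_trans.

Definition surface := {eq_quot glued_equiv}.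

(* [x] is the point of the closed atomic square [i] with coordinates [p]; a
   point on an edge or at a vertex has several such descriptions. *)
Definition in_square (x : surface) (i : squares P) (p : plane R) : Prop :=
  exists2 q : square_pt R, val q = p & x = \pi_surface (i, q)%qT.

(* A corner of the square [c.1]; the booleans choose right / left, top / bottom. *)
Definition is_corner (x : surface) (c : squares P * (bool * bool)) : bool :=
  `[< in_square x c.1 ((nat_of_bool c.2.1)%:R, (nat_of_bool c.2.2)%:R) >].

Definition vertex (x : surface) : Prop := exists c, is_corner x c.

(* Each corner of a square at the vertex [x] contributes a right angle. *)
Definition cone_angle (x : surface) : R :=
  #|[set c | is_corner x c]%SET|%:R * (pi / 2).

Definition singular (x : surface) : Prop :=
  vertex x /\ cone_angle x <> 2 * pi.

Definition torus := {z : R | 0 <= z < 1}.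

Definition frac_part (z : R) : R := z - (Num.floor z)%:~R.

Definition manifold := (surface * torus)%type.

(* As [in_square], with the third coordinate read modulo 1. *)
Definition in_cube (x : manifold) (i : squares P) (p : space3 R) : Prop :=
  in_square x.1 i p.1 /\ val x.2 = frac_part p.2.

Definition singular3 (x : manifold) : Prop := singular x.1.

End surface.

(* Straight line motion in a space [X] with charts indexed by [I]: [chart x i p]
   means that [x] is the point with coordinates [p] in the [i]-th closed cell. *)
Section geodesics.
Variables (R : realType) (X I : Type) (E : lmodType R).
Variables (chart : X -> I -> E -> Prop) (sing : X -> Prop).

Definition straight (u : E) (L : R -> X) (a b : R) : Prop :=
  exists i p, forall t, a <= t <= b -> chart (L t) i (p + (t - a) *: u).

(* [u] is the velocity.  One-sided pieces: at a time when [L] crosses from one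
   cell to another, the incoming and outgoing pieces lie in different cells.
   The values of [L] at negative times are irrelevant. *)
Definition half_infinite_motion (u : E) (L : R -> X) : Prop :=
  [/\ forall t, 0 <= t -> ~ sing (L t),
      forall t, 0 <= t -> exists2 e, 0 < e & straight u L t (t + e)
    & forall t, 0 < t -> exists2 e, 0 < e <= t & straight u L (t - e) t].

Definition region (i : I) (S : set E) : set X :=
  [set x | exists2 p, S p & chart x i p].

End geodesics.

Section equidistribution.
Variables (R : realType) (P : polysquare).

Definition norm2 (v : plane R) : R := Num.sqrt (v.1 ^+ 2 + v.2 ^+ 2).
Definition norm3 (w : space3 R) : R :=
  Num.sqrt (w.1.1 ^+ 2 + w.1.2 ^+ 2 + w.2 ^+ 2).

Definition half_infinite_geodesic2 (v : plane R) (L : R -> surface R P) : Prop :=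
  half_infinite_motion (@in_square R P) (@singular R P) ((norm2 v)^-1 *: v) L.

Definition half_infinite_geodesic3 (w : space3 R) (L : R -> manifold R P) : Prop :=
  half_infinite_motion (@in_cube R P) (@singular3 R P) ((norm3 w)^-1 *: w) L.

Definition half_infinite_kronecker_seq
    (v0 : surface R P) (v : plane R) (x : nat -> surface R P) : Prop :=
  exists L : R -> surface R P,
    [/\ half_infinite_geodesic2 v L, L 0 = v0
      & forall j : nat, x j = L (j%:R * norm2 v)].

Definition lambda1 : set R -> \bar R := @lebesgue_measure R.

Definition lambda2 : set (R * R) -> \bar R :=
  (@lebesgue_measure R \x @lebesgue_measure R)%E.

(* [\x^] integrates the areas of the horizontal slices.  It agrees with [\x] on
   Borel sets.  A convex set need not be Borel, but its slices are convex and,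
   by Brunn-Minkowski, their measures vary measurably; hence [lambda2] and
   [lambda3] give every convex set its Lebesgue measure. *)
Definition lambda3 : set (R * R * R) -> \bar R :=
  ((@lebesgue_measure R \x @lebesgue_measure R) \x^ @lebesgue_measure R)%E.

Definition square_set : set (plane R) := [set p | unit_square p].

Definition cube_set : set (space3 R) :=
  [set p | unit_square p.1 /\ 0 <= p.2 < 1].

Definition seq_unif_distributed (x : nat -> surface R P) : Prop :=
  forall (i : squares P) (S : set (plane R)),
    convex_set S -> S `<=` square_set ->
    (fun J : nat =>
       #|[set j : 'I_J | `[< region (@in_square R P) i S (x j) >]]%SET|%:R
         / J%:R : R) @ \oo
    --> (fine (lambda2 S) / #|squares P|%:R : R).

Definition geodesic_unif_distributed (L : R -> manifold R P) : Prop :=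
  forall (i : squares P) (S : set (space3 R)),
    convex_set S -> S `<=` cube_set ->
    (fine (lambda1 [set t | 0 <= t <= T /\ region (@in_cube R P) i S (L t)])
       / T) @[T --> +oo]
    --> (fine (lambda3 S) / #|squares P|%:R : R).

End equidistribution.

Definition kronecker_vector (R : realType) (v : plane R) : Prop :=
  forall a b c : rat, ratr a * v.1 + ratr b * v.2 + ratr c = 0 :> R ->
    [/\ a = 0, b = 0 & c = 0].

(* Main.v *)
Require Import Defs.
From mathcomp Require Import all_boot all_order all_algebra all_fingroup.
From mathcomp Require Import all_classical all_reals all_analysis.
From mathcomp Require Import measurable_realfun ring lra.

(** Why the equivalence holds.  Let [N] be the length of [(v, 1)].  A geodesic
    of [M] in direction [(v, 1)] is a geodesic of [P] run at such a speed that
    one unit of height takes the time [N], together with its height modulo 1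
    ([motion_height]).  Each time its height returns to a given value [z], its
    projection to [P] makes one more step of a Kronecker sequence with step [v].
    So the motion in [M] is a suspension of the sequences on [P].

    From sequences to geodesics.  Fix a convex [S] in an atomic cube.  The visits
    of [L] to [S] at height [z] are the visits of a Kronecker sequence to the
    convex slice of [S] at height [z], so by hypothesis their frequency tends to
    the area of the slice divided by the number of squares, for every [z].
    Cutting time into windows of length [N] expresses the time spent in [S] as
    the integral over [z] of these frequencies ([measure_window]); dominated
    convergence then gives the integral of the areas of the slices, which is the
    volume of [S] ([mean_window]), and times between two windows are squeezed in
    ([mean_time_window]).  The indicator of the visits is measurable because on
    each straight piece it is, up to the finitely many moments on the boundary of
    a square, the preimage of a convex set under an affine map
    ([measurable_visits_straight]).

    From geodesics to sequences.  Lift the sequence to [M].  If [S] is convex and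
    stays at a positive distance from the boundary of its square, then a
    slanted cylinder above [S] with axis direction [(v, 1)] and small height [e]
    is convex and inside the cube; by uniqueness of straight motion in the
    interior of a square the lifted geodesic spends exactly the time [N * e] in it
    for each index [j] with [x j] in [S] ([visit_slanted]).  This yields the right
    frequency for such [S].
    An arbitrary convex [S] is intersected with the core of the square, that is,
    its points within [d] of the boundary are dropped.  The cores of all squares
    have the correct frequencies themselves, so in the limit they leave a
    frequency of at most [4 * d] for everything that was dropped
    ([hits_modular], [seq_unif_distributed_core]). *)

Set Implicit Arguments.
Unset Strict Implicit.
Unset Printing Implicit Defensive.

Import Order.TTheory GRing.Theory Num.Theory.
Import numFieldNormedType.Exports.

Local Open Scope classical_set_scope.
Local Open Scope ring_scope.

(** * Locally constant predicates on an interval *)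

(** The form in which the connectedness of an interval is used.  The
    neighbourhoods are one-sided since a motion is straight only on one-sided
    pieces around the moments when it changes squares. *)
Lemma locally_constant_itv (R : realType) (D : R -> Prop) (a b : R) :
  a <= b ->
  (forall t, a <= t < b -> exists2 e : R, 0 < e &
     forall s : R, t <= s <= t + e -> s <= b -> (D s <-> D t)) ->
  (forall t, a < t <= b -> exists2 e : R, 0 < e &
     forall s : R, t - e <= s <= t -> a <= s -> (D s <-> D t)) ->
  D a <-> D b.
Proof.
move=> ab Dr Dl.
pose A := [set t | a <= t <= b /\ forall s, a <= s <= t -> (D s <-> D a)].
have Aa : A a.
  split; first by rewrite lexx.
  by move=> s /andP[? ?]; have -> : s = a by lra.
have supA : has_sup A by split; [exists a | exists b => x [/andP[]]].
pose c := sup A.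
have ac : a <= c by apply: ub_le_sup Aa; exists b => x [/andP[]].
have cb : c <= b by apply: ge_sup; [exists a | move=> x [/andP[]]].
have Alt s : a <= s -> s < c -> D s <-> D a.
  move=> as_ sc; have cs0 : 0 < c - s by lra.
  have [e [_ De] se] := sup_adherent cs0 supA.
  by apply: De; rewrite as_ /= ltW//; move: se; rewrite -/c; lra.
have Dc : D c <-> D a.
  have [<-//|ac'] := eqVneq a c.
  have {}ac' : a < c by rewrite lt_neqAle ac'.
  have [|e e0 De] := Dl c; first by rewrite ac'.
  pose s := Num.max a (c - e).
  have sc : s < c by rewrite /s gt_max ac'/=; lra.
  have as_ : a <= s by rewrite /s le_max lexx.
  have sD : D s <-> D c.
    by apply: De => //; apply/andP; split; [rewrite /s le_max lexx orbT | exact: ltW].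
  by have := Alt s as_ sc; tauto.
have [<-|cb'] := eqVneq c b; first exact: iff_sym.
have {}cb' : c < b by rewrite lt_neqAle cb'.
have [|e e0 De] := Dr c; first by rewrite ac.
pose s := Num.min b (c + e).
have cs : c < s by rewrite /s lt_min cb'/=; lra.
have sb : s <= b by rewrite /s ge_min lexx.
have ubA : has_ubound A by exists b => x [/andP[]].
suff /(ub_le_sup ubA) : A s by rewrite -/c; lra.
split; first by rewrite sb andbT; lra.
move=> r /andP[ar rs]; have [rc|cr] := ltP r c; first exact: Alt.
have rD : D r <-> D c; last by tauto.
apply: De; last exact: le_trans sb.
by rewrite cr (le_trans rs)// /s ge_min lexx orbT.
Qed.

(** * Affine changes of variable on the line *)

Section lebesgue_line.
Context {R : realType}.
Implicit Types (A : set R) (a b : R).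
Local Notation mu := (@lebesgue_measure R).

Lemma measurable_affine a b :
  measurable_fun setT (fun x : measurableTypeR R => a * x + b : measurableTypeR R).
Proof.
by apply: measurable_funD => //; exact: measurable_funM.
Qed.

Lemma measurable_preimage_affine a b A :
  measurable A -> measurable ((fun x => a * x + b) @^-1` A).
Proof.
by move=> mA; rewrite -[X in measurable X]setTI; exact: measurable_affine.
Qed.

Lemma lebesgue_measure_affine a b A : 0 < a -> measurable A ->
  (a%:E * mu ((fun x => a * x + b)%R @^-1` A) = mu A)%E.
Proof.
move=> a0 mA.
have mphi := @measurable_affine a b.
pose r : {nonneg R} := NngNum (ltW a0).
(* The rescaled pushforward of [mu] is a measure with the right value on
   intervals. *)
pose nu := measure_function_pushforward__canonical__measure_function_Measure
  mu mphi.
change (mscale r nu A = mu A).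
apply/esym/lebesgue_measure_unique => //= _ [[x y]] _ <-.
rewrite /mscale/= /pushforward/=.
have -> : (fun x0 => a * x0 + b) @^-1` `]x, y] =
    [set` `](x - b) / a, (y - b) / a]] :> set R.
  apply/seteqP; split => z /=; rewrite !in_itv/= (ltr_pdivrMr _ _ a0) (ler_pdivlMr _ _ a0);
    move=> /andP[? ?]; apply/andP; split; lra.
rewrite !lebesgue_measure_itv/= !lte_fin ltr_pM2r ?invr_gt0// ltrD2r.
case: ifPn => xy; last by rewrite mule0.
by rewrite -!EFinD -EFinM; congr EFin; field; rewrite gt_eqF.
Qed.
End lebesgue_line.

(** * Convex sets and their areas *)

Lemma scale_regularE (R : pzSemiRingType) (a x : R) : a *: (x : R^o) = a * x.
Proof. by []. Qed.

Section convex.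
Context {R : realType}.
Local Notation mu := (@lebesgue_measure R).

(** Avoids the bundled scalars of [{i01 R}] and the boolean membership of
    [convex_set]. *)
Lemma convex_setE (E : lmodType R) (S : set E) :
  convex_set S <->
  forall x y t, 0 <= t <= 1 -> S x -> S y -> S (t *: x + (1 - t) *: y).
Proof.
split => [cS x y t t01 Sx Sy|cS x y t].
  by have := cS x y (@Itv01 _ t (andP t01).1 (andP t01).2); rewrite !inE; exact.
by rewrite !inE => Sx Sy; apply: cS => //; apply/andP; split.
Qed.

Lemma convex_is_interval (S : set R^o) : convex_set S <-> is_interval S.
Proof.
rewrite convex_setE; split => [cS x y Sx Sy z /andP[xz zy]|iS x y t t01 Sx Sy].
  have [xy|yx] := ltP x y; last first.
    by have -> : z = x by lra.
  have -> : z = (y - z) / (y - x) *: (x : R^o) + (1 - (y - z) / (y - x)) *: (y : R^o).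
    by rewrite /GRing.scale /=; field; lra.
  apply: cS => //; rewrite divr_ge0 ?ler_pdivrMr ?mul1r; lra.
rewrite /GRing.scale /=.
have [xy|/ltW yx] := leP x y; [apply: (iS x y)|apply: (iS y x)] => //;
  apply/andP; split; nra.
Qed.

Lemma convex_preimage (E F : lmodType R) (f : E -> F) (S : set F) :
  (forall x y t, f (t *: x + (1 - t) *: y) = t *: f x + (1 - t) *: f y) ->
  convex_set S -> convex_set (f @^-1` S).
Proof.
move=> fE; rewrite !convex_setE => cS x y t t01 Sx Sy.
by rewrite /preimage/= fE; exact: cS.
Qed.

Lemma convex_setI (E : lmodType R) (A B : set E) :
  convex_set A -> convex_set B -> convex_set (A `&` B).
Proof.
rewrite !convex_setE => cA cB x y t t01 [Ax Bx] [Ay By].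
by split; [exact: cA|exact: cB].
Qed.

(** Turns a comparison of lengths into the existence of two points, so that it
    can be combined with convexity in [measurable_convex_xsection]. *)
Lemma interval_measure_gt (S : set R) (a : R) : is_interval S -> 0 <= a ->
  (a%:E < mu S)%E <-> exists x y, [/\ S x, S y & a < y - x].
Proof.
move=> iS a0; split=> [aS|[x [y [Sx Sy axy]]]].
  apply: contrapT => nS.
  have nSle x y : S x -> S y -> y - x <= a.
    by move=> Sx Sy; rewrite leNgt; apply/negP => axy; apply: nS; exists x, y.
  have [[x0 Sx0]|S0] := pselect (S !=set0); last first.
    have S00 : S = set0.
      by rewrite -subset0 => x Sx; apply: S0; exists x.
    by move: aS; rewrite S00 measure0 lte_fin ltNge a0.
  have lbS : has_lbound S.
    by exists (x0 - a) => y Sy; have := nSle _ _ Sy Sx0; lra.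
  have : (mu S <= mu `[inf S, (inf S + a)%R])%E.
    apply: le_measure; rewrite ?inE; [exact: is_interval_measurable|by []|].
    move=> y Sy; rewrite /= in_itv/=; apply/andP; split; first exact: ge_inf.
    rewrite -lerBlDr; apply: lb_le_inf; first by exists x0.
    by move=> x Sx; have := nSle _ _ Sx Sy; lra.
  rewrite lebesgue_measure_itv/= lte_fin; move: aS; case: ifPn => _ aS.
    by rewrite -EFinD addrAC subrr add0r leNgt aS.
  by move=> /(lt_le_trans aS); rewrite lte_fin ltNge a0.
apply: (@lt_le_trans _ _ (y - x)%:E); first by rewrite lte_fin.
have -> : (y - x)%:E = mu `[x, y].
  rewrite lebesgue_measure_itv/= lte_fin -EFinD.
  by case: ifPn => //; rewrite -leNgt => yx; exfalso; lra.
apply: le_measure; rewrite ?inE; [by []|exact: is_interval_measurable|].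
by move=> z; rewrite /= in_itv/=; exact: iS.
Qed.

Lemma convex_xsection (S : set (plane R)) x :
  convex_set S -> is_interval (xsection S x).
Proof.
rewrite -convex_is_interval !convex_setE => cS y z t t01.
rewrite /xsection/= !inE => Sy Sz.
by have := cS _ _ _ t01 Sy Sz; congr S; congr pair => /=; rewrite /GRing.scale/=; ring.
Qed.

(** A convex set of the plane need not be Borel, but the lengths of its vertical
    sections form a concave function on their support.  Hence for [0 <= a] the
    abscissas at which the length exceeds [a] form an interval: convex
    combinations of segments in two sections give a segment in the intermediate
    section. *)
Lemma measurable_convex_xsection (S : set (plane R)) :
  convex_set S -> measurable_fun setT (fun x => mu (xsection S x)).
Proof.
move=> cS.
apply: (measurability _ (ErealGenOInfty.measurableE R)) => // _ [_ [a ->] <-].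
rewrite setTI.
have [a0|a0] := leP 0 a; last first.
  rewrite (_ : _ @^-1` _ = setT)//; apply/seteqP; split => // x _ /=.
  by rewrite in_itv/= andbT; apply: lt_le_trans (measure_ge0 _ _); rewrite lte_fin.
apply: is_interval_measurable; apply/convex_is_interval/convex_setE.
move=> x y t t01 /=; rewrite !in_itv/= !andbT.
do 3 rewrite (interval_measure_gt (@convex_xsection S _ cS) a0).
move=> [x1 [x2 [Sx1 Sx2 ax]]] [y1 [y2 [Sy1 Sy2 ay]]].
move/convex_setE : cS => cS.
exists (t * x1 + (1 - t) * y1), (t * x2 + (1 - t) * y2); split.
- by move: Sx1 Sy1; rewrite /xsection/= !inE => Sx Sy; exact: (cS _ _ _ t01 Sx Sy).
- by move: Sx2 Sy2; rewrite /xsection/= !inE => Sx Sy; exact: (cS _ _ _ t01 Sx Sy).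
- move/andP: t01 => [t0 t1]; move: t0; rewrite le_eqVlt => /predU1P[<-|t0].
    by rewrite !mul0r subr0 !mul1r !add0r.
  have h1 : 0 < t * (x2 - x1 - a) by rewrite mulr_gt0// subr_gt0.
  have h2 : 0 <= (1 - t) * (y2 - y1 - a) by rewrite mulr_ge0// subr_ge0// ltW.
  lra.
Qed.

End convex.

Section area.
Context {R : realType}.
Local Notation mu := (@lebesgue_measure R).
Implicit Types S K : set (plane R).

(** The vertical shift is absorbed in each section, the horizontal one in the
    outer integral; the latter uses that the section lengths are measurable. *)
Lemma lambda2_shift S (w : plane R) :
  convex_set S -> lambda2 [set p | S (p - w)] = lambda2 S.
Proof.
move=> cS; rewrite /lambda2 /product_measure1.
pose phi : measurableTypeR R -> measurableTypeR R := fun x => 1 * x - w.1.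
have mphi : measurable_fun setT phi by exact: measurable_affine.
transitivity (\int[mu]_x ((fun y => mu (xsection S y)) \o phi) x)%E.
  apply: eq_integral => x _ /=.
  have mS := is_interval_measurable (@convex_xsection R S (phi x) cS).
  rewrite -(lebesgue_measure_affine (- w.2) ltr01 mS) mul1e; congr (mu _).
  by apply/seteqP; split => y /=; rewrite /xsection/= !inE /phi !mul1r.
rewrite -(@ge0_integral_pushforward _ _ _ _ _ phi mphi mu setT
  (fun y => mu (xsection S y)) measurableT (measurable_convex_xsection cS))//.
apply: eq_measure_integral => A mA _ /=.
by rewrite /pushforward -[LHS]mul1e; exact: lebesgue_measure_affine.
Qed.

Lemma convex_rect a b c d :
  convex_set [set p : plane R | (a <= p.1 <= b) && (c <= p.2 <= d)].
Proof.
apply/convex_setE => x y t /andP[t0 t1] /=.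
rewrite /GRing.scale/= => /andP[/andP[? ?] /andP[? ?]] /andP[/andP[? ?] /andP[? ?]].
by repeat (apply/andP; split); nra.
Qed.

Lemma lambda2_rect a b c d : a <= b -> c <= d ->
  lambda2 [set p : plane R | (a <= p.1 <= b) && (c <= p.2 <= d)]
  = ((b - a) * (d - c))%:E.
Proof.
move=> ab cd; rewrite (_ : [set _ | _] = `[a, b] `*` `[c, d]); last first.
  by apply/seteqP; split => -[x y] /=; rewrite !in_itv/= => /andP.
rewrite /lambda2 product_measure1E//= !lebesgue_measure_itv/= !lte_fin -!EFinD.
have aux (u v : R) : u <= v -> (if u < v then (v - u)%:E else 0%E) = (v - u)%:E.
  by rewrite le_eqVlt => /predU1P[->|->//]; rewrite ltxx subrr.
by rewrite !aux// -EFinM.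
Qed.

Lemma lambda2_square_set : lambda2 (@square_set R) = 1%E.
Proof. by rewrite [LHS]lambda2_rect// !subr0 mulr1. Qed.

Lemma convex_square_set : convex_set (@square_set R).
Proof. exact: convex_rect. Qed.

(** As convex sets need not be measurable for the product structure, additivity
    of the area is obtained section by section. *)
Lemma lambda2_modular S K : convex_set S -> convex_set K ->
  S `<=` @square_set R -> K `<=` @square_set R ->
  (lambda2 S + lambda2 K <= lambda2 (S `&` K) + 1)%E.
Proof.
move=> cS cK S1 K1.
have mE (T : set (plane R)) : convex_set T -> measurable_fun setT (fun x => mu (xsection T x)).
  exact: measurable_convex_xsection.
have cQ := convex_square_set.
rewrite -[in leRHS]lambda2_square_set /lambda2 /product_measure1.
rewrite -!ge0_integralD//; last 4 first.
- by apply: mE; exact: convex_setI.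
- exact: mE.
- exact: mE.
- exact: mE.
apply: ge0_le_integral => //.
- by move=> x _; rewrite adde_ge0.
- by apply: emeasurable_funD; exact: mE.
- by apply: emeasurable_funD; apply: mE => //; exact: convex_setI.
move=> x _ /=.
have mS T (cT : convex_set T) := is_interval_measurable (@convex_xsection R T x cT).
have mSx := mS _ cS; have mKx := mS _ cK.
rewrite xsectionI (measureDI mu mSx mKx).
rewrite addeAC addeC leeD2l// -measureU//; last 2 first.
- exact: measurableD.
- by apply/seteqP; split => // y [[]].
apply: le_measure; rewrite ?inE.
- by apply: measurableU => //; exact: measurableD.
- exact: mS.
by move=> y [[+ _]|]; rewrite /xsection/= !inE; [exact: S1|exact: K1].
Qed.

Lemma le_lambda2 S K : convex_set S -> convex_set K -> S `<=` K ->
  (lambda2 S <= lambda2 K)%E.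
Proof.
move=> cS cK SK; apply: ge0_le_integral => //.
- exact: measurable_convex_xsection.
- exact: measurable_convex_xsection.
move=> x _ /=; apply: le_measure; rewrite ?inE.
- exact: is_interval_measurable (@convex_xsection R S x cS).
- exact: is_interval_measurable (@convex_xsection R K x cK).
- by move=> y; rewrite /xsection/= !inE => /SK.
Qed.

Lemma lambda2_fin_num S : convex_set S -> S `<=` @square_set R ->
  lambda2 S \is a fin_num.
Proof.
move=> cS /(le_lambda2 cS convex_square_set); rewrite lambda2_square_set => S1.
by rewrite ge0_fin_numE ?(le_lt_trans S1) ?ltry//; exact: integral_ge0.
Qed.

Lemma lambda3_slices (S : set (space3 R)) (D : set R) : (forall p, S p -> D p.2) ->
  lambda3 S = (\int[mu]_(z in D) lambda2 (ysection S z))%E.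
Proof.
move=> SD; rewrite /lambda3 /product_measure2 [RHS]integral_mkcond.
apply: eq_integral => z _; rewrite /patch; case: ifPn => //.
rewrite notin_setE => nDz; rewrite /= (_ : ysection S z = set0) ?measure0//.
by apply/seteqP; split => // p; rewrite /ysection/= inE => /SD.
Qed.

End area.

(** * Points of the surface *)

Section surface_points.
Variables (R : realType) (P : polysquare).
Implicit Types (x : surface R P) (i : squares P) (p : plane R).

Definition interior_pt (p : plane R) : bool := (0 < p.1 < 1) && (0 < p.2 < 1).

(** The two generating identifications only involve points on edges. *)
Lemma glued_interior (a b : raw_pt R P) :
  interior_pt (val a.2) -> glued a b -> a = b.
Proof.
move=> ia /asboolP ab.
suff : interior_pt (val a.2) || interior_pt (val b.2) -> a = b.
  by apply; rewrite ia.
elim: ab => {a b ia}//= [a b||a b c _ IHab _ IHbc].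
- by rewrite /interior_pt => -[] [_ a1 b0 _]; rewrite a1 b0 !ltxx /= ?andbF.
- by move=> a b _ IH; rewrite orbC => /IH.
move=> /orP[ia|ic].
  have ab : a = b by apply: IHab; rewrite ia.
  by rewrite ab; apply: IHbc; rewrite -ab ia.
have bc : b = c by apply: IHbc; rewrite ic orbT.
by rewrite -bc; apply: IHab; rewrite bc ic orbT.
Qed.

Lemma in_square_unit x i p : in_square x i p -> unit_square p.
Proof. by move=> [q <- _]; exact: valP. Qed.

Lemma in_square_interior x i p j q :
  in_square x i p -> in_square x j q -> interior_pt p -> i = j /\ p = q.
Proof.
move=> [p' <- ->] [q' <-] /eqmodP/= pq ip.
by have [-> ->] := glued_interior (ip : interior_pt (val (i, p').2)) pq.
Qed.

End surface_points.

(** * Heights modulo 1 *)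

Section frac_part.
Variable R : realType.
Implicit Types x y : R.

Lemma frac_part_itv x : 0 <= frac_part x < 1.
Proof.
rewrite /frac_part; have := floor_itv x; rewrite intrD => /andP[? ?].
by apply/andP; split; lra.
Qed.

Lemma frac_part_eqP x y :
  frac_part x = frac_part y <-> exists k : int, x = y + k%:~R.
Proof.
split=> [xy|[k ->]].
  exists (Num.floor x - Num.floor y); rewrite intrB.
  by move: xy; rewrite /frac_part; lra.
by rewrite /frac_part floorDrz ?intr_int// intrKfloor intrD; ring.
Qed.

Lemma frac_part_id x : 0 <= x < 1 -> frac_part x = x.
Proof.
by move=> x01; rewrite /frac_part (@floor_def _ x 0) ?subr0// add0r.
Qed.

End frac_part.

(** * Straight line motions *)

Section motions.
Variables (R : realType) (I : Type).

Lemma straight_sub (X : Type) (E : lmodType R) (chart : X -> I -> E -> Prop)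
    (u : E) (L : R -> X) (a b c d : R) :
  a <= c -> d <= b -> straight chart u L a b -> straight chart u L c d.
Proof.
move=> ac db [i [p Lp]]; exists i, (p + (c - a) *: u) => t /andP[ct td].
have -> : p + (c - a) *: u + (t - c) *: u = p + (t - a) *: u.
  by rewrite -addrA -scalerDl; congr (_ + _ *: _); lra.
by apply: Lp; apply/andP; split; lra.
Qed.

(** Projecting a geodesic of [M] to [P] and lifting one from [P] to [M] are both
    of this form.  The map [G] between the coordinates may depend on the time,
    as the height of the lift does; the hypothesis on [G] alone says that it
    carries straight motion at velocity [u] to straight motion at velocity
    [u']. *)
Lemma motion_transfer (X X' : Type) (E E' : lmodType R)
    (chart : X -> I -> E -> Prop) (chart' : X' -> I -> E' -> Prop)
    (sing : X -> Prop) (sing' : X' -> Prop)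
    (u : E) (u' : E') (L : R -> X) (L' : R -> X') (al be : R)
    (G : R -> E -> E') :
  0 < al -> 0 <= be ->
  (forall t, 0 <= t -> sing' (L' t) -> sing (L (al * t + be))) ->
  (forall t i p, 0 <= t -> chart (L (al * t + be)) i p -> chart' (L' t) i (G t p)) ->
  (forall t s p, G (t + s) (p + (al * s) *: u) = G t p + s *: u') ->
  half_infinite_motion chart sing u L -> half_infinite_motion chart' sing' u' L'.
Proof.
move=> al0 be0 sing_tr chart_tr Glin [Lns Lr Ll].
have pos t : 0 <= t -> 0 <= al * t + be by move=> t0; rewrite addr_ge0 ?mulr_ge0// ltW.
have str_tr a b : 0 <= a -> straight chart u L (al * a + be) (al * b + be) ->
    straight chart' u' L' a b.
  move=> a0 [i [p Lp]]; exists i, (G a p) => t /andP[at_ tb].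
  rewrite -Glin addrCA subrr addr0; apply: chart_tr; first exact: le_trans at_.
  have -> : al * (t - a) = al * t + be - (al * a + be) by ring.
  by apply: Lp; rewrite !lerD2r !ler_pM2l// at_.
split=> [t t0|t t0|t t0].
- by move=> /(sing_tr _ t0); exact/Lns/pos.
- have [e e0 Le] := Lr _ (pos _ t0); exists (e / al); first by rewrite divr_gt0.
  apply: str_tr => //; apply: straight_sub Le => //.
  by rewrite mulrDr mulrCA divff ?gt_eqF// mulr1 addrAC.
- have abt : 0 < al * t + be by rewrite ltr_wpDr// mulr_gt0.
  have [e /andP[e0 _] Le] := Ll _ abt.
  (* The piece of [L'] before [t] must not start before time 0, whereas that
     of [L] may reach back to a time below [be]. *)
  pose d := Num.min (e / al) t.
  have de : al * d <= e.
    by rewrite mulrC -ler_pdivlMr// /d ge_min lexx.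
  exists d; first by rewrite /d lt_min divr_gt0//= t0 ge_min lexx orbT.
  apply: str_tr; first by rewrite subr_ge0 /d ge_min lexx orbT.
  by apply: straight_sub Le => //; rewrite mulrBr; lra.
Qed.

(** A property whose truth does not change along any straight piece does not
    change along the motion. *)
Lemma motion_invariant (X : Type) (E : lmodType R) (chart : X -> I -> E -> Prop)
    (sing : X -> Prop) (u : E) (L : R -> X) (D : R -> Prop) (a b : R) :
  half_infinite_motion chart sing u L -> 0 <= a -> a <= b ->
  (forall c d, a <= c -> c <= d -> d <= b -> straight chart u L c d -> (D c <-> D d)) ->
  D a <-> D b.
Proof.
move=> [_ Lr Ll] a0 ab cstD; apply: locally_constant_itv => // t /andP[at_ tb].
  have [|e e0 Le] := Lr t; first exact: le_trans at_.
  exists e => // s /andP[ts se] sb.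
  by symmetry; apply: cstD => //; exact: straight_sub Le.
have [|e /andP[e0 et] Le] := Ll t; first exact: le_lt_trans at_.
exists e => // s /andP[es st] as_.
by apply: cstD => //; exact: straight_sub Le.
Qed.

End motions.

(** * Uniqueness of the motion inside a square and in height *)

Section flow.
Variables (R : realType) (P : polysquare).

(** An interior point has a unique description, so along a straight piece the
    motion either follows the prescribed line in the square [i] all the time or
    never.  The equivalence makes the statement usable both forwards and
    backwards in time. *)
Lemma motion_interior (sing : surface R P -> Prop) (u : plane R)
    (L : R -> surface R P) (a b : R) (i : squares P) (p : plane R) :
  half_infinite_motion (@in_square R P) sing u L -> 0 <= a -> a <= b ->
  (forall t, a <= t <= b -> interior_pt (p + (t - a) *: u)) ->
  in_square (L a) i p <-> in_square (L b) i (p + (b - a) *: u).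
Proof.
move=> mL a0 ab ip.
pose D t := in_square (L t) i (p + (t - a) *: u).
suff : D a <-> D b by rewrite /D subrr scale0r addr0.
apply: (motion_invariant mL) => // c d ac cd db [j [q Lq]].
have DE t : c <= t <= d -> D t <-> (i = j /\ p + (c - a) *: u = q).
  move=> /[dup] tcd /andP[ct td].
  have pE : p + (t - a) *: u = p + (c - a) *: u + (t - c) *: u.
    by rewrite -addrA -scalerDl; congr (_ + _ *: _); lra.
  split=> [Dt|[ij pq]]; last by rewrite /D pE pq ij; exact: Lq.
  have [|->] := in_square_interior Dt (Lq _ tcd).
    by apply: ip; apply/andP; split; lra.
  by rewrite pE => /addIr.
by rewrite DE ?lexx// DE ?lexx ?cd.
Qed.

(** Along a straight piece the difference of the two heights is constant, so
    it is an integer either everywhere or nowhere. *)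
Lemma motion_height (sing : manifold R P -> Prop) (u : space3 R)
    (L : R -> manifold R P) (t : R) :
  half_infinite_motion (@in_cube R P) sing u L -> 0 <= t ->
  val (L t).2 = frac_part (val (L 0).2 + t * u.2).
Proof.
move=> mL t0.
pose D s := val (L s).2 = frac_part (val (L 0).2 + s * u.2).
suff : D 0 <-> D t.
  case=> + _; apply; rewrite /D mul0r addr0 frac_part_id//.
  exact: valP (L 0).2.
apply: (motion_invariant mL) => // c d c0 cd dt [j [q Lq]].
have DE s : c <= s <= d -> D s <-> exists k : int, q.2 - c * u.2 = val (L 0).2 + k%:~R.
  move=> scd; rewrite /D (Lq _ scd).2 frac_part_eqP/= /GRing.scale/=.
  by split=> -[k kE]; exists k; lra.
by rewrite DE ?lexx// DE ?lexx ?cd.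
Qed.

End flow.

(** * Measurability of the visits to a convex set *)

Section visits.
Variables (R : realType) (P : polysquare).
Variables (u : space3 R) (L : R -> manifold R P) (i : squares P).
Variable S : set (space3 R).
Hypotheses (u1 : u.1.1 != 0) (u2 : u.1.2 != 0) (cS : convex_set S).

Let visit t := region (@in_cube R P) i S (L t).

(** [B] collects the times at which the line crosses one of the four lines that
    bound the square; at all other times the position has a unique description,
    so a visit to [S] is a condition on the coordinates of the line, up to the
    integer [k] by which its height differs from that of a point of [S].  Both
    [u.1.1] and [u.1.2] must be nonzero for [B] to be finite. *)
Lemma measurable_visits_straight a b :
  straight (@in_cube R P) u L a b ->
  measurable ([set t | a <= t <= b /\ visit t] : set (measurableTypeR R)).
Proof.
move=> [j [[[q1 q2] h] Lq]].
pose q t : space3 R := (q1, q2, h) + (t - a) *: u.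
pose B : set R := [set a - q1 / u.1.1; a + (1 - q1) / u.1.1;
                       a - q2 / u.1.2; a + (1 - q2) / u.1.2].
have fB : finite_set B by rewrite /B !finite_setU; do ! split => //; exact: finite_set1.
have q_int t : a <= t <= b -> ~ B t -> interior_pt (q t).1.
  move=> /Lq[/in_square_unit + _] nB; rewrite -/(q t).
  rewrite /unit_square /interior_pt/= /GRing.scale/=.
  move=> /andP[/andP[c10 c11] /andP[c20 c21]].
  rewrite !lt_neqAle c10 c11 c20 c21 !andbT.
  apply/andP; split; apply/andP; split; apply/eqP => E; apply: nB.
  - left; left; left; have -> : q1 = (a - t) * u.1.1; [by lra|by rewrite /=; field].
  - left; left; right; have -> : 1 - q1 = (t - a) * u.1.1; [by lra|by rewrite /=; field].
  - left; right; have -> : q2 = (a - t) * u.1.2; [by lra|by rewrite /=; field].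
  - right; have -> : 1 - q2 = (t - a) * u.1.2; [by lra|by rewrite /=; field].
pose C := [set t | exists k : int, S ((q t).1, (q t).2 - k%:~R)].
have mC : measurable (C : set (measurableTypeR R)).
  rewrite (_ : C = \bigcup_k [set t | S ((q t).1, (q t).2 - k%:~R)]); last first.
    by apply/seteqP; split=> [t [k Sk]|t [k _ Sk]]; exists k.
  apply: countable_bigcupT_measurable; first exact: countableP.
  move=> k; apply: is_interval_measurable; apply/convex_is_interval.
  apply: convex_preimage cS => x y t; rewrite /q /GRing.scale/=.
  by congr (_, _, _); rewrite /= !scale_regularE; ring.
rewrite (_ : [set t | _] = (B `&` [set t | a <= t <= b /\ visit t]) `|`
   ((`[a, b] `\` B) `&` if i == j then C else set0)); last first.
  apply/seteqP; split=> t /=.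
    move=> [tab vt]; have [Bt|nBt] := pselect (B t); [by left|right].
    split; first by rewrite in_itv.
    move: vt => -[p Sp [p1 p2]]; have [Lt1 Lt2] := Lq _ tab.
    have [ji pE] := in_square_interior Lt1 p1 (q_int _ tab nBt).
    rewrite ji eqxx.
    have /esym/frac_part_eqP[k kE] : frac_part p.2 = frac_part (q t).2.
      by rewrite -p2 -Lt2.
    exists k; rewrite pE kE addrK; by case: p Sp {p1 p2 pE kE}.
  move=> [[]//|[[tab nBt]]]; rewrite in_itv/= in tab.
  case: eqP => // ij [k Sk]; split => //; have [Lt1 Lt2] := Lq _ tab.
  exists ((q t).1, (q t).2 - k%:~R) => //; split; rewrite ?ij//=.
  by rewrite Lt2; apply/frac_part_eqP; exists k; rewrite subrK.
apply: measurableU.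
  apply: countable_measurable => //.
  by apply: finite_set_countable; exact: finite_setIl.
apply: measurableI; last by case: ifP.
by apply: measurableD => //; apply: countable_measurable => //; exact: finite_set_countable.
Qed.

(** Measurability of the visits up to time [t] is a property of [t] that is
    constant along straight pieces. *)
Lemma measurable_visits sing T : half_infinite_motion (@in_cube R P) sing u L ->
  measurable ([set t | 0 <= t <= T /\ visit t] : set (measurableTypeR R)).
Proof.
move=> mL.
pose V a b : set (measurableTypeR R) := [set t | a <= t <= b /\ visit t].
have [T0|T0] := ltP T 0.
  rewrite (_ : [set _ | _] = set0)//; apply/seteqP; split=> // t [] /andP[? ?]; lra.
pose D t := measurable (V 0 t).
suff [+ _] : D 0 <-> D T.
  apply; apply: countable_measurable => //.
  apply: (@sub_countable _ _ _ [set (0:R)]); last exact: countable1.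
  by apply: subset_card_le => t [] /andP[? ?]; rewrite /=; lra.
apply: (motion_invariant mL) => // c d c0 cd dT Lcd; split=> [Dc|Dd].
  rewrite /D (_ : V 0 d = V 0 c `|` V c d).
    by apply: measurableU => //; exact: measurable_visits_straight.
  apply/seteqP; split=> [t [/andP[t0 td] vt]|t [[/andP[? ?] vt]|[/andP[? ?] vt]]].
  - by have [tc|ct] := leP t c; [left|right]; split=> //; apply/andP; split; lra.
  - by split=> //; apply/andP; split; lra.
  - by split=> //; apply/andP; split; lra.
rewrite /D (_ : V 0 c = V 0 d `&` `[0, c]); first exact: measurableI.
apply/seteqP; split=> t /=; rewrite in_itv/=.
  by move=> [/andP[? ?] vt]; do ! split=> //; apply/andP; split; lra.
by move=> [[_ vt]].
Qed.

Lemma measurable_visit_times sing : half_infinite_motion (@in_cube R P) sing u L ->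
  measurable ([set t | 0 <= t /\ visit t] : set (measurableTypeR R)).
Proof.
move=> mL; rewrite (_ : [set _ | _] = \bigcup_n [set t | 0 <= t <= n%:R /\ visit t]).
  by apply: bigcupT_measurable => n; exact: measurable_visits mL.
apply/seteqP; split=> [t [t0 vt]|t [n _ [/andP[]]]//].
exists (Num.truncn t).+1 => //; split=> //; rewrite t0/=.
by apply/ltW; exact: truncnS_gt.
Qed.

End visits.

(** * Time averages as averages over the fibres *)

Section mean_time.
Variables (R : realType) (E : set R) (N b : R).
Hypotheses (N0 : 0 < N) (b0 : 0 <= b).
Hypothesis mE : measurable (E : set (measurableTypeR R)).
Local Notation mu := (@lebesgue_measure R).

(** [N * z + (N * j%:R + b)] is the moment of phase [z] in the [j]th of the
    successive windows of length [N] that begin at time [b]. *)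
Definition visit_count J (z : R) : R := \sum_(j < J) \1_E (N * z + (N * j%:R + b)).

Lemma measurable_visit_count J :
  measurable_fun setT (visit_count J : measurableTypeR R -> measurableTypeR R).
Proof.
apply: measurable_sum => j.
apply: measurableT_comp; last exact: measurable_affine.
exact: measurable_indic.
Qed.

Lemma visit_count_itv J z : 0 <= visit_count J z <= J%:R.
Proof.
apply/andP; split; first by apply: sumr_ge0 => j _; rewrite indicE.
rewrite -[J in leRHS]card_ord -sumr_const.
by apply: ler_sum => j _; rewrite indicE; case: (_ \in _).
Qed.

Lemma visit_count_card J z :
  visit_count J z =
  #|[set j : 'I_J | `[< E (N * z + (N * j%:R + b)) >]]%SET|%:R.
Proof.
rewrite /visit_count -sum1dep_card natr_sum [RHS]big_mkcond/=.
apply: eq_bigr => j _; rewrite indicE.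
by case: asboolP => h; [rewrite mem_set|rewrite memNset].
Qed.

(** The [j]th window is the image of the unit interval under an affine map of
    slope [N]. *)
Lemma measure_window J :
  mu (E `&` `[b, b + N * J%:R[) =
  (N%:E * \int[mu]_(z in `[0%R, 1%R[) (visit_count J z)%:E)%E.
Proof.
elim: J => [|J IH].
  rewrite mulr0 addr0 set_itvco0 setI0 measure0 integral0_eq ?mule0// => z _.
  by rewrite /visit_count big_ord0.
have -> : E `&` `[b, b + N * J.+1%:R[ =
    (E `&` `[b, b + N * J%:R[) `|` (E `&` `[b + N * J%:R, b + N * J.+1%:R[).
  rewrite -setIUr; congr (_ `&` _); apply/seteqP; clear IH.
  have N_gt0 := N0.
  have NJ : 0 <= N * J%:R by rewrite mulr_ge0// ltW.
  rewrite -natr1 mulrDr mulr1.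
  split=> t /=; rewrite !in_itv/=.
    move=> /andP[bt tb].
    by have [?|?] := ltP t (b + N * J%:R); [left|right]; apply/andP; split; lra.
  by move=> [/andP[? ?]|/andP[? ?]]; apply/andP; split; lra.
rewrite measureU; last 3 first.
- exact: measurableI.
- exact: measurableI.
- apply/seteqP; split=> // t /= [[_ +] [_]]; rewrite !in_itv/= => /andP[_ +] /andP[+ _].
  by move=> /lt_le_trans /[apply]; rewrite ltxx.
rewrite /= IH; under [in RHS]eq_integral => z _ do
  rewrite /visit_count big_ord_recr/= EFinD.
pose phi z := N * z + (N * J%:R + b).
have mphiE : measurable (phi @^-1` E : set (measurableTypeR R)).
  exact: measurable_preimage_affine.
rewrite ge0_integralD//; last 3 first.
- by move=> z _; rewrite lee_fin; case/andP: (visit_count_itv J z).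
- apply/measurable_EFinP; apply: measurable_funS (measurable_visit_count J) => //.
- apply/measurable_EFinP; apply: (@measurable_indic _ _ _ _ (phi @^-1` E)).
  exact: mphiE.
rewrite [RHS]ge0_muleDr; last 2 first.
- apply: integral_ge0 => z _; rewrite lee_fin.
  by case/andP: (visit_count_itv J z).
- by apply: integral_ge0 => z _; rewrite lee_fin indicE.
congr (_ + _)%E.
rewrite (@integral_indic _ _ _ mu _ _ (phi @^-1` E))//.
rewrite -(lebesgue_measure_affine (N * J%:R + b) N0); last exact: measurableI.
congr (_ * mu _)%E; apply/seteqP; rewrite -natr1 mulrDr mulr1; clear IH.
have N_gt0 := N0.
by split=> z /= [Ez]; rewrite !in_itv/= => /andP[? ?]; split => //;
  apply/andP; split; nra.
Qed.

(** The frequencies are bounded by 1, so dominated convergence applies to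
    [s] times the frequencies.  The limit [g] is measurable as a pointwise limit,
    which for the areas of the slices of a convex body would not be obvious
    directly. *)
Lemma mean_window (s : R) (g : R -> R) : 0 < s ->
  (forall z, 0 <= z < 1 -> visit_count J z / J%:R @[J --> \oo] --> g z / s) ->
  fine (mu (E `&` `[b, b + N * J%:R[)) / (N * J%:R) @[J --> \oo] -->
  fine (\int[mu]_(z in `[0%R, 1%R[) (g z)%:E) / s.
Proof.
move=> s0 cvg_g.
pose f J z := (s * (visit_count J z / J%:R))%:E.
pose D : set (measurableTypeR R) := `[0, 1[%classic.
have mD : measurable D by exact: measurable_itv.
have mf J : measurable_fun D (f J).
  apply/measurable_EFinP; apply: measurable_funM => //; apply: measurable_funM => //.
  exact: measurable_funS (measurable_visit_count J).
have f_g z : D z -> f J z @[J --> \oo] --> (g z)%:E.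
  rewrite /D/= in_itv/= => /cvg_g h; apply: cvg_EFin; first exact: nearW.
  rewrite [X in _ --> X](_ : g z = s * (g z / s)); first exact: cvgMl_tmp.
  by rewrite mulrC divfK// gt_eqF.
have mg : measurable_fun D (EFin \o g) by exact: (emeasurable_fun_cvg f).
have ics : mu.-integrable D (cst s%:E).
  apply/integrableP; split => //.
  rewrite integral_cst//= lebesgue_measure_itv/= lte_fin ltr01 oppr0 adde0 mule1.
  by rewrite ltry.
have fs J z : D z -> (`|f J z| <= s%:E)%E.
  move=> _; rewrite /f abse_EFin lee_fin; have /andP[c0 cJ] := visit_count_itv J z.
  rewrite ger0_norm; last by rewrite mulr_ge0 ?divr_ge0// ltW.
  rewrite ler_piMr ?(ltW s0)//; case: J cJ c0 => [|J] cJ c0; first by rewrite invr0 mulr0.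
  by rewrite ler_pdivrMr// mul1r.
have [||ig _ cvg_f] := @dominated_convergence _ _ _ mu _ mD f (EFin \o g)
  (cst s%:E) mf mg _ ics.
- by apply/aeW => z; exact: f_g.
- by apply/aeW => z J; exact: fs.
have gfin := integrable_fin_num mD ig.
have intf J : (\int[mu]_(z in D) f J z =
    ((s / J%:R)%:E * \int[mu]_(z in D) (visit_count J z)%:E))%E.
  rewrite -ge0_integralZl_EFin//.
  - by apply: eq_integral => z _; rewrite /f -EFinM; congr EFin; ring.
  - by move=> z _; rewrite lee_fin; case/andP: (visit_count_itv J z).
  - apply/measurable_EFinP; exact: measurable_funS (measurable_visit_count J).
  - by rewrite divr_ge0// ltW.
have {}cvg_f : fine (\int[mu]_(z in D) f J z) @[J --> \oo] -->
    fine (\int[mu]_(z in D) (g z)%:E).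
  by apply: fine_cvg; rewrite fineK.
have : fine (\int[mu]_(z in D) f J z) / s @[J --> \oo] -->
    fine (\int[mu]_(z in D) (g z)%:E) / s.
  exact: cvgMr_tmp.
apply: cvg_trans; apply: near_eq_cvg; near=> J.
have J0 : (0 < J)%N by near: J; exists 1%N.
rewrite measure_window intf -/D.
have : (\int[mu]_(z in D) (visit_count J z)%:E)%E \is a fin_num.
  rewrite ge0_fin_numE; last first.
    by apply: integral_ge0 => z _; rewrite lee_fin; case/andP: (visit_count_itv J z).
  apply: (@le_lt_trans _ _ (\int[mu]_(z in D) (J%:R)%:E)%E).
    apply: ge0_le_integral => //.
    - by move=> z _; rewrite lee_fin; case/andP: (visit_count_itv J z).
    - apply/measurable_EFinP; exact: measurable_funS (measurable_visit_count J).
    - by move=> z _; rewrite lee_fin; case/andP: (visit_count_itv J z).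
  rewrite integral_cst//= lebesgue_measure_itv/= lte_fin ltr01 oppr0 adde0 mule1.
  by rewrite ltry.
move=> /fineK <-; rewrite -!EFinM/=; field.
by rewrite (gt_eqF N0) (gt_eqF s0) pnatr_eq0 -lt0n J0.
Unshelve. all: by end_near. Qed.

Lemma measure_itv_fin (a c : R) A : measurable (A : set (measurableTypeR R)) ->
  mu (A `&` `[a, c]) \is a fin_num.
Proof.
move=> mA; rewrite ge0_fin_numE//; apply: (@le_lt_trans _ _ (mu `[a, c])).
  by apply: le_measure; rewrite ?inE//; exact: measurableI.
by rewrite lebesgue_measure_itv/=; case: ifP => _; rewrite -?EFinD ltry.
Qed.

(** Between [E] up to time [T] and the windows contained in it, apart from the
    first [b], the difference in measure is at most [b + N]. *)
Lemma mean_time_window (c : R) :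
  fine (mu (E `&` `[b, b + N * J%:R[)) / (N * J%:R) @[J --> \oo] --> c ->
  fine (mu (E `&` `[0, T])) / T @[T --> +oo] --> c.
Proof.
move=> cvg_c; have N_gt0 := N0; have b_ge0 := b0.
pose a J := fine (mu (E `&` `[b, b + N * J%:R[)).
pose m T := fine (mu (E `&` `[0, T])).
have itvE x y : x <= y -> mu `[x, y] = (y - x)%:E.
  rewrite lebesgue_measure_itv/= lte_fin le_eqVlt => /predU1P[->|->].
    by rewrite ltxx subrr.
  by rewrite -EFinD.
have itvE' x y : x <= y -> mu `[x, y[ = (y - x)%:E.
  rewrite lebesgue_measure_itv/= lte_fin le_eqVlt => /predU1P[->|->].
    by rewrite ltxx subrr.
  by rewrite -EFinD.
have NJ J : 0 <= N * J%:R by rewrite mulr_ge0// ltW.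
have aE J : mu (E `&` `[b, b + N * J%:R[) = (a J)%:E.
  rewrite fineK// ge0_fin_numE//; apply: (@le_lt_trans _ _ (mu `[b, b + N * J%:R[)).
    by apply: le_measure; rewrite ?inE//; exact: measurableI.
  by rewrite itvE' ?ltry// lerDl.
have mTE T : mu (E `&` `[0, T]) = (m T)%:E by rewrite fineK// measure_itv_fin.
have a_le J : 0 <= a J <= N * J%:R.
  rewrite -!lee_fin -aE measure_ge0/=.
  have -> : (N * J%:R)%:E = mu `[b, b + N * J%:R[.
    by rewrite itvE' ?lerDl// addrAC subrr add0r.
  by apply: le_measure; rewrite ?inE//; exact: measurableI.
have close J T : N * J%:R <= T -> T <= N * J%:R + N -> `|m T - a J| <= b + N.
  move=> JT TJ; have NJ0 := NJ J; rewrite ler_distl; apply/andP; split.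
    rewrite lerBlDr -lee_fin EFinD -aE -mTE.
    have -> : (b + N)%:E = mu `[T, T + (b + N)].
      by rewrite itvE; [congr EFin; ring|lra].
    apply: (@le_trans _ _ (mu (E `&` `[0, T] `|` `[T, T + (b + N)]))); last first.
      by apply: measureU2 => //; exact: measurableI.
    apply: le_measure; rewrite ?inE.
    - exact: measurableI.
    - by apply: measurableU => //; exact: measurableI.
    move=> t [Et]; rewrite /= !in_itv/= => /andP[? ?].
    by have [?|?] := leP t T; [left; split=> //|right]; apply/andP; split; lra.
  rewrite -lee_fin EFinD -aE -mTE.
  have -> : (b + N)%:E = (mu `[0%R, b] + mu `[(b + N * J%:R)%R, (b + N * J%:R + N)%R])%E.
    by rewrite !itvE -?EFinD; [congr EFin; ring|lra|lra].
  rewrite [leRHS]addeCA.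
  apply: (@le_trans _ _ (mu (`[0, b] `|` ((E `&` `[b, b + N * J%:R[) `|`
     `[b + N * J%:R, b + N * J%:R + N])))); last first.
    apply: le_trans (measureU2 _ _ _) _ => //.
      by apply: measurableU => //; exact: measurableI.
    rewrite leeD2l//; apply: measureU2 => //; exact: measurableI.
  apply: le_measure; rewrite ?inE.
  - exact: measurableI.
  - by apply: measurableU => //; apply: measurableU => //; exact: measurableI.
  move=> t [Et]; rewrite /= !in_itv/= => /andP[? ?].
  have [?|?] := leP t b; [by left; apply/andP|right].
  have [?|?] := ltP t (b + N * J%:R); [left; split=> //|right];
  by apply/andP; split; lra.
apply/cvgrPdist_le => e e0.
have e20 : 0 < e / 2 by lra.
move/cvgrPdist_le : cvg_c => /(_ _ e20)[J0 _ cvg_c].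
near=> T.
have T0 : N < T by near: T; apply: nbhs_pinfty_gt; exact: num_real.
have TJ0 : N * J0.+1%:R < T by near: T; apply: nbhs_pinfty_gt; exact: num_real.
have Te : (b + N + N) / (e / 2) < T by near: T; apply: nbhs_pinfty_gt; exact: num_real.
pose J := Num.truncn (T / N).
have T_gt0 : 0 < T by exact: lt_trans T0.
have /andP[JT TJ] : N * J%:R <= T <= N * J%:R + N.
  have /truncn_itv/andP[] : 0 <= T / N by rewrite divr_ge0// ltW.
  rewrite -/J ler_pdivlMr// ltr_pdivrMr// -natr1 => h1 h2.
  by apply/andP; split; lra.
have J0J : (J0.+1 <= J)%N.
  by rewrite /J truncn_ge_nat ?divr_ge0 ?(ltW T_gt0) ?(ltW N0)// ler_pdivlMr// mulrC ltW.
have NJ0 : 0 < N * J%:R.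
  by rewrite mulr_gt0// ltr0n; exact: leq_trans J0J.
have /= cJ := cvg_c J (ltnW J0J).
have mJ := close J T JT TJ.
have /andP[aJ0 aJ] := a_le J.
rewrite -/(m T); rewrite -/(a J) in cJ.
have -> : c - m T / T = (c - a J / (N * J%:R)) +
    (((T - N * J%:R) * (a J / (N * J%:R)) - (m T - a J)) / T).
  by field; rewrite (gt_eqF T_gt0) (gt_eqF N0) pnatr_eq0 -lt0n (leq_trans _ J0J).
rewrite (splitr e); apply: le_trans (ler_normD _ _) _; apply: lerD => //.
rewrite normrM [X in _ * X]ger0_norm ?invr_ge0 ?(ltW T_gt0)// ler_pdivrMr//.
apply: (@le_trans _ _ (N + (b + N))).
  apply: le_trans (ler_normB _ _) _; apply: lerD => //.
  have q0 : 0 <= a J / (N * J%:R) by rewrite divr_ge0// ltW.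
  have q1 : a J / (N * J%:R) <= 1 by rewrite ler_pdivrMr// mul1r.
  rewrite ger0_norm; last by rewrite mulr_ge0// subr_ge0.
  rewrite -[leRHS]mulr1 ler_pM// ?subr_ge0//; lra.
by move: Te; rewrite ltr_pdivrMr//; lra.
Unshelve. all: by end_near. Qed.

End mean_time.

(** * From Kronecker sequences to geodesics *)

Section directions.
Context {R : realType}.
Implicit Types v : plane R.

Lemma kronecker_vector_neq0 v : kronecker_vector v -> v.1 != 0 /\ v.2 != 0.
Proof.
move=> kv; split; apply/eqP => v0.
  have [] := kv 1 0 0; last by move/eqP; rewrite oner_eq0.
  by rewrite v0 rmorph1 !rmorph0 mulr0 mul0r !addr0.
have [] := kv 0 1 0; last by move=> _ /eqP; rewrite oner_eq0.
by rewrite v0 rmorph1 !rmorph0 mulr0 mul0r !addr0.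
Qed.

Lemma norm2_gt0 v : v.1 != 0 -> 0 < norm2 v.
Proof.
move=> v10; rewrite sqrtr_gt0 ltr_pwDl ?sqr_ge0//.
by rewrite lt_neqAle eq_sym sqrf_eq0 v10 sqr_ge0.
Qed.

Lemma norm3_gt0 v : 0 < norm3 ((v, 1) : space3 R).
Proof. by rewrite sqrtr_gt0 /= expr1n ltr_wpDl// addr_ge0 ?sqr_ge0. Qed.

End directions.

Section surface_to_manifold.
Variables (R : realType) (P : polysquare) (v : plane R).
Hypothesis kv : kronecker_vector v.
Local Notation mu := (@lebesgue_measure R).
Let N := norm3 ((v, 1) : space3 R).

(** The starting time [b] is free: every point of the geodesic starts a
    Kronecker sequence. *)
Lemma project_geodesic (L : R -> manifold R P) (b : R) : 0 <= b ->
  half_infinite_geodesic3 ((v, 1) : space3 R) L ->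
  half_infinite_geodesic2 v (fun t => (L (N / norm2 v * t + b)).1).
Proof.
move=> b0 gL; have N0 : 0 < N := norm3_gt0 v.
have v0 := norm2_gt0 (kronecker_vector_neq0 kv).1.
apply: (motion_transfer (al := N / norm2 v) (be := b) (G := fun _ p => p.1)
  _ _ _ _ _ gL) => //.
- by rewrite divr_gt0.
- by move=> t i p _ [].
- move=> _ s p /=; rewrite /= !scalerA -/N; congr (_ + _ *: v).
  by field; rewrite !gt_eqF.
Qed.

(** The windows start at the time [b] when the height first returns to 0, so
    that the phase [z] within a window is the height. *)
Lemma kronecker_implies_geodesic :
  (forall (v0 : surface R P) (x : nat -> surface R P),
     half_infinite_kronecker_seq v0 v x -> seq_unif_distributed x) ->
  forall L : R -> manifold R P,
    half_infinite_geodesic3 ((v, 1) : space3 R) L -> geodesic_unif_distributed L.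
Proof.
move=> ud L gL i S cS S1; have N0 : 0 < N := norm3_gt0 v.
have [v10 v20] := kronecker_vector_neq0 kv; have v0 := norm2_gt0 v10.
pose s : R := #|squares P|%:R.
have s0 : 0 < s by rewrite ltr0n squares_gt0.
pose visit t := region (@in_cube R P) i S (L t).
pose E := [set t | 0 <= t /\ visit t].
have mE : measurable (E : set (measurableTypeR R)).
  by apply: (@measurable_visit_times R P _ L i S _ _ cS _ gL) => //=;
    rewrite scale_regularE mulf_neq0// invr_eq0 gt_eqF.
pose z0 := val (L 0).2.
have /andP[z00 z01] : 0 <= z0 < 1 := valP (L 0).2.
pose b := N * (1 - z0).
have b0 : 0 <= b by rewrite mulr_ge0 ?subr_ge0// ltW.
have height t : 0 <= t -> val (L t).2 = frac_part (z0 + t / N).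
  by move=> /(motion_height gL) ->; rewrite /= scale_regularE mulr1.
pose Sz z : set (plane R) := (fun p => (p, z)) @^-1` S.
have SzE z : ysection S z = Sz z.
  by apply/seteqP; split=> p; rewrite /ysection/= inE.
have cSz z : convex_set (Sz z).
  apply: (@convex_preimage R (plane R) (space3 R) _ _ _ cS) => p q t.
  by congr pair; rewrite /= !scale_regularE; ring.
have Sz1 z : Sz z `<=` @square_set R by move=> p /S1[].
have visit_count_cvg z : 0 <= z < 1 ->
    visit_count E N b J z / J%:R @[J --> \oo] --> fine (lambda2 (Sz z)) / s.
  move=> /andP[z_ge0 z_lt1].
  pose x j := (L (N * z + (N * j%:R + b))).1.
  have udx : seq_unif_distributed x.
    apply: (ud (L (N / norm2 v * 0 + (N * z + b))).1).
    exists (fun t => (L (N / norm2 v * t + (N * z + b))).1); split => //.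
      by apply: project_geodesic gL; rewrite addr_ge0// mulr_ge0// ltW.
    by move=> j; rewrite /x; congr ((L _).1); field; rewrite !gt_eqF.
  have := udx i (Sz z) (cSz z) (Sz1 z); apply: cvg_trans; apply: near_eq_cvg.
  apply: nearW => J /=; rewrite visit_count_card; congr (_%:R / _).
  apply: eq_card => j; rewrite !inE; apply/asbool_equiv_eq.
  have t0 : 0 <= N * z + (N * j%:R + b) by rewrite !addr_ge0// mulr_ge0// ltW.
  have hz : val (L (N * z + (N * j%:R + b))).2 = z.
    rewrite height// -[RHS]frac_part_id; last by apply/andP; split.
    apply/frac_part_eqP; exists (Posz j.+1); rewrite /b -pmulrn -natr1; field.
    by rewrite gt_eqF.
  split=> [[p Sp xp]|[_ [[p h] Sp [/= xp hE]]]].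
    split=> //; exists (p, z) => //; split=> //=.
    by rewrite hz frac_part_id//; apply/andP; split.
  exists p => //; rewrite /Sz/=.
  suff -> : z = h by [].
  by rewrite [z](etrans (esym hz) hE) frac_part_id//; case: (S1 _ Sp).
have := mean_time_window N0 b0 mE (mean_window N0 mE s0 visit_count_cvg).
rewrite -/s (_ : fine _ = fine (lambda3 S)).
  apply: cvg_trans; apply: near_eq_cvg; apply: nearW => T /=.
  congr (fine (lambda1 _) / _); apply/seteqP; split=> t /=; rewrite in_itv/=.
    by move=> [[]].
  by move=> [/andP[t0 tT] vt]; rewrite t0 tT.
rewrite (@lambda3_slices _ S `[0, 1[%classic); last first.
  by move=> p /S1[]; rewrite /= in_itv.
congr fine; apply: eq_integral => z _.
by rewrite SzE fineK//; exact: lambda2_fin_num (cSz z) (Sz1 z).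
Qed.

End surface_to_manifold.

(** * Frequencies of visits to squares and to their cores *)

Section counting.
Variables (R : realType) (P : polysquare).
Implicit Types (x : nat -> surface R P) (i : squares P) (S K : set (plane R)).

Definition hits x i S J : nat :=
  #|[set j : 'I_J | `[< region (@in_square R P) i S (x j) >]]%SET|.

Lemma hitsE x i S J :
  hits x i S J = (\sum_(j < J) `[< region (@in_square R P) i S (x j) >])%N.
Proof.
rewrite /hits -sum1dep_card big_mkcond/=; apply: eq_bigr => j _.
by case: asboolP.
Qed.

Lemma le_hits x i S K J : S `<=` K -> (hits x i S J <= hits x i K J)%N.
Proof.
move=> SK; rewrite !hitsE; apply: leq_sum => j _.
case: asboolP => // -[p Sp xp]; case: asboolP => // nK.
by exfalso; apply: nK; exists p => //; exact: SK.
Qed.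

(** A point lies in at most one square of which it is an interior point, and
    if it lies in some [K] then any other description of it is the same.  This
    bounds the visits to [S] outside [K] by the times that the sequence avoids
    every copy of [K]. *)
Lemma hits_modular x i S K J : (forall p, K p -> interior_pt p) ->
  (hits x i S J + \sum_i' hits x i' K J <= hits x i (S `&` K) J + J)%N.
Proof.
move=> Kint; under [X in (_ + X)%N]eq_bigr do rewrite hitsE.
rewrite exchange_big/= !hitsE -big_split/=.
rewrite -[X in (_ <= _ + X)%N]card_ord -sum1_card -big_split/=.
apply: leq_sum => j _.
have [[i' [p' Kp' xp']]|nK] := pselect (exists i', region (@in_square R P) i' K (x j)).
  have uniq i'' q : in_square (x j) i'' q -> i'' = i' /\ q = p'.
    by move=> /(in_square_interior xp') /(_ (Kint _ Kp'))[-> ->].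
  rewrite (bigD1 i')//= big1 ?addn0; last first.
    move=> i'' ni; case: asboolP => // -[q _ /uniq[ii _]].
    by rewrite ii eqxx in ni.
  apply: leq_add; last exact: leq_b1.
  case: asboolP => // -[p Sp xp]; case: asboolP => // nSK.
  exfalso; apply: nSK; exists p => //; split=> //.
  by have [_ ->] := uniq _ _ xp.
rewrite big1 ?addn0; last first.
  by move=> i' _; case: asboolP => // Ki'; exfalso; apply: nK; exists i'.
by apply: leq_trans (leq_b1 _) _; rewrite leq_addl.
Qed.

Definition core (d : R) : set (plane R) :=
  [set p | (d <= p.1 <= 1 - d) && (d <= p.2 <= 1 - d)].

(** The area of the square outside the core is at most [4 * d]; by
    [hits_modular] and [lambda2_modular], in the limit neither the frequency nor
    the area of [S] changes by more when [S] is cut down to the core. *)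
Lemma seq_unif_distributed_core x :
  (forall d, 0 < d < 1 / 2 -> forall i S, convex_set S -> S `<=` core d ->
     (hits x i S J)%:R / J%:R @[J --> \oo] -->
     fine (lambda2 S) / #|squares P|%:R) ->
  seq_unif_distributed x.
Proof.
move=> cvg_core i S cS S1; set s : R := #|squares P|%:R.
have s1 : 1 <= s by rewrite ler1n squares_gt0.
apply/cvgrPdist_le => e e0.
pose d := Num.min (1 / 4) (e / 16).
have d0 : 0 < d by rewrite lt_min; apply/andP; split; lra.
have d4 : d <= 1 / 4 by rewrite ge_min lexx.
have de : d <= e / 16 by rewrite ge_min lexx orbT.
have d12 : 0 < d < 1 / 2 by apply/andP; split => //; lra.
pose K := core d.
have cK : convex_set K by exact: convex_rect.
have K1 : K `<=` @square_set R.
  by move=> p /andP[/andP[? ?] /andP[? ?]]; do 2 (apply/andP; split); lra.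
have cSK := convex_setI cS cK.
have lK : fine (lambda2 K) = (1 - d - d) ^+ 2.
  by rewrite lambda2_rect//=; lra.
have cvgK i' := cvg_core d d12 i' K cK (fun p h => h).
have cvgSK := cvg_core d d12 i (S `&` K) cSK (fun p h => h.2).
have {}cvgK :
    \sum_i' ((hits x i' K J)%:R / J%:R) @[J --> \oo] --> fine (lambda2 K).
  rewrite [X in _ --> X](_ : _ = \sum_(i' : squares P) fine (lambda2 K) / s).
    by apply: cvg_big => [|i' _]; [exact: add_continuous|exact: cvgK].
  rewrite sumr_const -[#|_|]/(#|squares P|) -mulr_natr -/s divfK//.
  by rewrite gt_eqF// (lt_le_trans ltr01).
have e40 : 0 < e / 4 by lra.
move/cvgrPdist_le : cvgK => /(_ _ e40) nearK.
move/cvgrPdist_le : cvgSK => /(_ _ e40) nearSK.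
have modular : fine (lambda2 S) + fine (lambda2 K) <= fine (lambda2 (S `&` K)) + 1.
  have SK1 : S `&` K `<=` @square_set R by move=> p [/S1].
  have := lambda2_modular cS cK S1 K1.
  rewrite -(fineK (lambda2_fin_num cS S1)) -(fineK (lambda2_fin_num cK K1)).
  by rewrite -(fineK (lambda2_fin_num cSK SK1)) -!EFinD lee_fin.
have monotone : fine (lambda2 (S `&` K)) <= fine (lambda2 S).
  have SK1 : S `&` K `<=` @square_set R by move=> p [/S1].
  by apply: fine_le; [exact: lambda2_fin_num..|apply: le_lambda2 => // p []].
near=> J.
have J0 : 0 < J%:R :> R by rewrite ltr0n; near: J; exists 1%N.
have /= nK : `|fine (lambda2 K) - \sum_i' (hits x i' K J)%:R / J%:R| <= e / 4.
  by near: J.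
have /= nSK : `|fine (lambda2 (S `&` K)) / s - (hits x i (S `&` K) J)%:R / J%:R| <= e / 4.
  by near: J.
pose fS : R := (hits x i S J)%:R / J%:R.
pose fSK : R := (hits x i (S `&` K) J)%:R / J%:R.
pose fK : R := \sum_i' (hits x i' K J)%:R / J%:R.
have fSKS : fSK <= fS.
  by rewrite ler_pM2r ?invr_gt0// ler_nat; apply: le_hits => p [].
have fmod : fS + fK <= fSK + 1.
  rewrite /fS /fK /fSK -mulr_suml -mulrDl.
  rewrite -[X in _ <= _ + X](divff (lt0r_neq0 J0)) -mulrDl.
  rewrite ler_pM2r ?invr_gt0// -natr_sum -!natrD ler_nat; apply: hits_modular.
  by move=> p /andP[/andP[? ?] /andP[? ?]]; do 2 (apply/andP; split); lra.
rewrite -/s -/(fS).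
move: nK nSK; rewrite -/fK -/fSK !ler_norml => /andP[K1' K2'] /andP[SK1' SK2'].
have lKe : 1 - fine (lambda2 K) <= e / 4 by rewrite lK expr2; nra.
have sv0 : 0 < s^-1 by rewrite invr_gt0 (lt_le_trans ltr01).
have sv1 : s^-1 <= 1 by rewrite invf_le1// (lt_le_trans ltr01).
have m1 : fine (lambda2 (S `&` K)) / s <= fine (lambda2 S) / s by rewrite ler_pM2r.
have m2 : fine (lambda2 S) / s <= fine (lambda2 (S `&` K)) / s + e / 4.
  have h : 0 <= 1 - fine (lambda2 K) by rewrite lK expr2; nra.
  apply: (@le_trans _ _ ((fine (lambda2 (S `&` K)) + (1 - fine (lambda2 K))) / s)).
    by rewrite ler_pM2r//; lra.
  rewrite mulrDl lerD2l; apply: le_trans lKe.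
  by rewrite ler_piMr.
by apply/andP; split; lra.
Unshelve. all: by end_near. Qed.

End counting.

(** * From geodesics to Kronecker sequences *)

Section manifold_to_surface.
Variables (R : realType) (P : polysquare) (v : plane R).
Hypothesis kv : kronecker_vector v.
Local Notation mu := (@lebesgue_measure R).
Let N := norm3 ((v, 1) : space3 R).

(** The summand 0 matches the affine change of time in [motion_transfer]. *)
Definition lift_geodesic (L : R -> surface R P) (t : R) : manifold R P :=
  (L (norm2 v / N * t + 0), exist _ (frac_part (t / N)) (frac_part_itv (t / N))).

Lemma lift_geodesicP (L : R -> surface R P) :
  half_infinite_geodesic2 v L -> half_infinite_geodesic3 ((v, 1) : space3 R) (lift_geodesic L).
Proof.
move=> gL; have N0 : 0 < N := norm3_gt0 v.
have v0 := norm2_gt0 (kronecker_vector_neq0 kv).1.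
apply: (motion_transfer (al := norm2 v / N) (be := 0)
  (G := fun t p => ((p, t / N) : space3 R)) _ _ _ _ _ gL) => //.
- by rewrite divr_gt0.
- move=> t s p /=; rewrite -/N; congr (_, _).
    rewrite !scalerA; congr (_ + _ *: v).
    by field; rewrite !gt_eqF.
  by rewrite /= !scale_regularE; field; rewrite gt_eqF.
Qed.

(** Over the height [z] this is [S] moved by [z *: v], which is where a point of
    [S] is carried in the time that the height needs to grow by [z]. *)
Definition slanted (S : set (plane R)) (e : R) : set (space3 R) :=
  [set q | 0 <= q.2 < e /\ S (q.1 - q.2 *: v)].

Lemma convex_slanted S e : convex_set S -> convex_set (slanted S e).
Proof.
move=> cS.
pose f (q : space3 R) : plane R := q.1 - q.2 *: v.
rewrite (_ : slanted S e = (fun q : space3 R => q.2) @^-1` `[0, e[ `&` f @^-1` S).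
  apply: convex_setI.
    apply: (@convex_preimage R (space3 R) R^o) => //.
    by apply/convex_is_interval; exact: interval_is_interval.
  apply: convex_preimage cS => x y t; rewrite /f/=.
  by congr pair; rewrite /= !scale_regularE; ring.
by apply/seteqP; split=> q /=; rewrite in_itv.
Qed.

Lemma lambda3_slanted S e : 0 < e -> convex_set S -> S `<=` @square_set R ->
  lambda3 (slanted S e) = (e * fine (lambda2 S))%:E.
Proof.
move=> e0 cS S1.
rewrite (@lambda3_slices _ _ `[0, e[%classic); last first.
  by move=> p []; rewrite /= in_itv.
transitivity (\int[mu]_(z in `[0%R, e[) (lambda2 S))%E.
  apply: eq_integral => z; rewrite inE/= in_itv/= => ze.
  rewrite -(lambda2_shift (z *: v) cS); congr lambda2.
  by apply/seteqP; split=> p; rewrite /ysection/= inE /slanted/= => // -[].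
rewrite -[in LHS](fineK (lambda2_fin_num cS S1)) integral_cst//=.
by rewrite lebesgue_measure_itv/= lte_fin e0 oppr0 adde0 -EFinM mulrC.
Qed.

(** While the height grows from 0 to [z < e], a point of the core moves by less
    than [d] in each coordinate and so remains in the interior of its square, where
    [motion_interior] applies. *)
Lemma visit_slanted (L : R -> surface R P) (i : squares P) S (d e z : R) (j : nat) :
  half_infinite_geodesic2 v L -> S `<=` core d -> 0 < d ->
  e * `|v.1| < d -> e * `|v.2| < d -> e <= 1 -> 0 <= z < 1 ->
  region (@in_cube R P) i (slanted S e) (lift_geodesic L (N * z + N * j%:R)) <->
  z < e /\ region (@in_square R P) i S (L (j%:R * norm2 v)).
Proof.
move=> gL Sd d0 ev1 ev2 e1 z01; have N0 : 0 < N := norm3_gt0 v.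
have v0 := norm2_gt0 (kronecker_vector_neq0 kv).1.
have v_neq0 : norm2 v != 0 by rewrite gt_eqF.
have height : frac_part ((N * z + N * j%:R) / N) = z.
  rewrite -[RHS]frac_part_id//; apply/frac_part_eqP; exists (Posz j).
  by rewrite -pmulrn; field; rewrite gt_eqF.
have timeE : norm2 v / N * (N * z + N * j%:R) + 0 = j%:R * norm2 v + z * norm2 v.
  by field; rewrite gt_eqF.
have /andP[z0 z1] := z01.
have flow p : z < e -> S p ->
    in_square (L (j%:R * norm2 v)) i p <->
    in_square (L (j%:R * norm2 v + z * norm2 v)) i (p + z *: v).
  move=> ze /Sd /andP[/andP[p10 p11] /andP[p20 p21]].
  have := @motion_interior R P _ _ L (j%:R * norm2 v) (j%:R * norm2 v + z * norm2 v) i p gL.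
  rewrite addrAC subrr add0r scalerA mulfK//; apply.
  - by rewrite mulr_ge0// ltW.
  - by rewrite lerDl mulr_ge0// ltW.
  move=> t /andP[t0 t1]; rewrite scalerA.
  set w := (t - _) / _.
  have w0 : 0 <= w by rewrite divr_ge0 ?subr_ge0// ltW.
  have we : w < e by apply: le_lt_trans ze; rewrite ler_pdivrMr//; lra.
  have small a : e * `|a| < d -> - d < w * a < d.
    move=> ea; rewrite -ltr_norml normrM ger0_norm//.
    by apply: le_lt_trans ea; rewrite ler_wpM2r// ltW.
  have /andP[? ?] := small _ ev1; have /andP[? ?] := small _ ev2.
  by do 2 (apply/andP; split); rewrite /= scale_regularE; lra.
split=> [[[p h] [/= /andP[h0 he] Sp] [/= xp]]|[ze [p Sp xp]]].
  rewrite height frac_part_id; last by rewrite h0 (lt_le_trans he).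
  move=> zh; move: xp Sp he; rewrite -zh => xp Sp ze; split=> //.
  exists (p - z *: v) => //; apply/flow => //.
  by rewrite subrK; move: xp; rewrite timeE.
exists (p + z *: v, z).
  by split; rewrite /= ?z0 ?ze// addrK.
split=> /=; last by rewrite height frac_part_id.
by rewrite timeE; apply/flow.
Qed.

Lemma slanted_cube S (d e : R) : S `<=` core d ->
  e * `|v.1| < d -> e * `|v.2| < d -> e <= 1 -> slanted S e `<=` @cube_set R.
Proof.
move=> Sd ev1 ev2 e1 [p h] [/= /andP[h0 he] /Sd].
have small a : e * `|a| < d -> - d < h * a < d.
  move=> ea; rewrite -ltr_norml normrM ger0_norm//.
  by apply: le_lt_trans ea; rewrite ler_wpM2r// ltW.
have /andP[? ?] := small _ ev1; have /andP[? ?] := small _ ev2.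
move=> /andP[/andP[/= + +] /andP[/= + +]]; rewrite !scale_regularE => ? ? ? ?.
by split; [do 2 (apply/andP; split)|apply/andP; split] => /=; lra.
Qed.

Lemma geodesic_implies_kronecker :
  (forall L : R -> manifold R P,
    half_infinite_geodesic3 ((v, 1) : space3 R) L -> geodesic_unif_distributed L) ->
  forall (v0 : surface R P) (x : nat -> surface R P),
    half_infinite_kronecker_seq v0 v x -> seq_unif_distributed x.
Proof.
move=> ud v0 x [L [gL _ xE]].
have N0 : 0 < N := norm3_gt0 v.
have [v10 v20] := kronecker_vector_neq0 kv.
apply: seq_unif_distributed_core => d /andP[d0 d12] i S cS Sd.
set s : R := #|squares P|%:R.
(* Makes [e] at most 1 and both [e * `|v.1|] and [e * `|v.2|] less than [d]. *)
pose e : R := d / (1 + d + `|v.1| + `|v.2|).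
have a1 := normr_ge0 v.1; have a2 := normr_ge0 v.2.
have den0 : 0 < 1 + d + `|v.1| + `|v.2| by lra.
have e0 : 0 < e by rewrite divr_gt0.
have e1 : e <= 1 by rewrite ler_pdivrMr//; lra.
have ev1 : e * `|v.1| < d by rewrite mulrAC ltr_pdivrMr// ltr_pM2l//; lra.
have ev2 : e * `|v.2| < d by rewrite mulrAC ltr_pdivrMr// ltr_pM2l//; lra.
have S1 : S `<=` @square_set R.
  by move=> p /Sd/andP[/andP[? ?] /andP[? ?]]; do 2 (apply/andP; split); lra.
have gL3 := lift_geodesicP gL.
pose visit t := region (@in_cube R P) i (slanted S e) (lift_geodesic L t).
pose E := [set t | 0 <= t /\ visit t].
have mE : measurable (E : set (measurableTypeR R)).
  by apply: (@measurable_visit_times R P _ _ i _ _ _ (@convex_slanted S e cS) _ gL3) => //=;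
    rewrite scale_regularE mulf_neq0// invr_eq0 gt_eqF.
have count z J : 0 <= z < 1 ->
    visit_count E N 0 J z = (hits x i S J)%:R * \1_(`[0, e[%classic : set R) z.
  move=> z01; have /andP[z0 z1] := z01; rewrite visit_count_card indicE.
  have Ej (j : 'I_J) : E (N * z + (N * j%:R + 0)) <->
      z < e /\ region (@in_square R P) i S (x j).
    have := visit_slanted i j gL Sd d0 ev1 ev2 e1 z01.
    rewrite xE addr0 => <-; split=> [[]//|Ev]; split=> //.
    by rewrite addr_ge0// mulr_ge0// ltW.
  have [ze|ze] := ltP z e.
    rewrite mem_set/= ?in_itv/= ?z0// mulr1; congr (_%:R); apply: eq_card => j.
    by rewrite !inE; apply/asbool_equiv_eq; rewrite Ej; split=> [[]|].
  rewrite memNset/= ?mulr0; last by rewrite in_itv/= z0/= ltNge ze.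
  rewrite (_ : [set j | _]%SET = finset.set0) ?cards0//; apply/setP => j.
  by rewrite !inE; apply/asboolP => /Ej[]; rewrite ltNge ze.
have window J : mu (E `&` `[0, N * J%:R[) = (N * ((hits x i S J)%:R * e))%:E.
  have := measure_window 0 N0 mE J; rewrite add0r => ->.
  rewrite EFinM; congr (_ * _)%E.
  under eq_integral => z do rewrite inE/= in_itv/= => /(count _ J) ->.
  under eq_integral => z _ do rewrite EFinM.
  rewrite ge0_integralZl_EFin//; last first.
    apply/measurable_EFinP; exact: measurable_indic.
  rewrite integral_indic// EFinM; congr (_ * _)%E.
  rewrite (_ : _ `&` _ = `[0, e[%classic); last first.
    apply/seteqP; split=> [z []//|z]; rewrite /= !in_itv/= => /andP[z0 ze].
    by rewrite z0 ze (lt_le_trans ze).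
  by rewrite /= lebesgue_measure_itv/= lte_fin e0 oppr0 adde0.
(* The time average is over a closed interval; its endpoint has measure 0. *)
have closed_window J :
    lambda1 [set t | 0 <= t <= N * J%:R /\ visit t] = (N * ((hits x i S J)%:R * e))%:E.
  have NJ : 0 <= N * J%:R by rewrite mulr_ge0// ltW.
  pose W : set (measurableTypeR R) := [set t | 0 <= t <= N * J%:R /\ visit t].
  have mW : measurable W.
    by apply: (@measurable_visits R P _ _ i _ _ _ (@convex_slanted S e cS) _ _ gL3) => //=;
      rewrite scale_regularE mulf_neq0// invr_eq0 gt_eqF.
  apply/eqP; rewrite -window eq_le; apply/andP; split.
    apply: (@le_trans _ _ (mu ((E `&` `[0, N * J%:R[) `|` [set N * J%:R]))).
      apply: le_measure; rewrite ?inE//.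
      - by apply: measurableU => //; exact: measurableI.
      - move=> t [/andP[t0]]; rewrite le_eqVlt => /predU1P[->|tJ] vt; [by right|left].
        by split=> //; rewrite /= in_itv/= t0 tJ.
    rewrite measureU0//; last exact: lebesgue_measure_set1.
    exact: measurableI.
  apply: le_measure; rewrite ?inE//; first exact: measurableI.
  move=> t [[t0 vt]]; rewrite /= in_itv/= => /andP[_ tJ].
  by split=> //; rewrite t0 ltW.
have cvgT := ud _ gL3 i _ (@convex_slanted S e cS) (slanted_cube Sd ev1 ev2 e1).
rewrite lambda3_slanted//= in cvgT.
have NJy : (N * J%:R : R) @[J --> \oo] --> +oo.
  apply/cvgryPge => A; move/cvgryPge : (@cvgr_idn R) => /(_ (A / N)).
  by apply: filterS => J; rewrite ler_pdivrMr// mulrC.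
have s0 : s != 0 by rewrite gt_eqF// ltr0n squares_gt0.
rewrite [X in _ --> X](_ : _ = e * fine (lambda2 S) / s / e); last first.
  by field; rewrite gt_eqF.
have cvgJ := cvgMr_tmp (b := e^-1) (cvg_comp _ _ NJy cvgT).
apply: cvg_trans (cvgJ _); apply: near_eq_cvg; near=> J.
have J0 : (0 < J)%N by near: J; exists 1%N.
rewrite /= closed_window/=; field.
by rewrite (gt_eqF N0) (gt_eqF e0) pnatr_eq0 -lt0n J0.
Unshelve. all: by end_near. Qed.

End manifold_to_surface.

Theorem theorem1 (R : realType) (P : polysquare) (v : plane R)
    (hv : kronecker_vector v) :
  (forall (v0 : surface R P) (x : nat -> surface R P),
      half_infinite_kronecker_seq v0 v x -> seq_unif_distributed x)
  <->
  (forall L : R -> manifold R P,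
      half_infinite_geodesic3 ((v, 1) : space3 R) L ->
      geodesic_unif_distributed L).
Proof.
split; first exact: kronecker_implies_geodesic.
exact: geodesic_implies_kronecker.
Qed.
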